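(* Let $V=\mathbb C[a,b,c,c^{-1},(c-ab)^{-1}]$ be the ring of regular functions on $\{(a,b,c)\in\mathbb C^3:c\ne0,\ c\neq ab\}$, equipped with the Lie bracket $$\{f,g\}=g\,\partial_3f-f\,\partial_3g+\partial_1f\,\partial_2g-\partial_1g\,\partial_2f .$$ Then the Lie algebra $(V,\{\cdot,\cdot\})$ contains a Lie subalgebra isomorphic to $\mathfrak{sl}_3(\mathbb C)$.
   Context: Here $\partial_1=\frac{\partial}{\partial a}$, $\partial_2=\frac{\partial}{\partial b}+a\frac{\partial}{\partial c}$, $\partial_3=\frac{\partial}{\partial c}$. *)

(* Defs.v *)
From HB Require Import structures.
From mathcomp Require Import all_boot all_order all_algebra.
From mathcomp Require Import mpoly.
From mathcomp Require Import complex.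
From mathcomp Require Import boolp.
From mathcomp Require Import reals.
From mathcomp Require Import ring.

Set Implicit Arguments.
Unset Strict Implicit.
Unset Printing Implicit Defensive.

Import GRing.Theory.
Local Open Scope ring_scope.
Local Open Scope quotient_scope.

(** * Lie algebras, subalgebras and isomorphisms *)

HB.mixin Record Lmodule_isLieAlgebra (K : fieldType) L of GRing.Lmodule K L := {
  lie : L -> L -> L;
  lie_linearl : forall (k : K) (x y z : L),
    lie (k *: x + y) z = k *: lie x z + lie y z;
  lie_linearr : forall (k : K) (x y z : L),
    lie z (k *: x + y) = k *: lie z x + lie z y;
  liexx : forall x : L, lie x x = 0;
  lie_jacobi : forall x y z : L,
    lie x (lie y z) + lie y (lie z x) + lie z (lie x y) = 0 }.

#[short(type="lieAlgType")]
HB.structure Definition LieAlgebra (K : fieldType) :=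
  { L of GRing.Lmodule K L & Lmodule_isLieAlgebra K L }.

Definition lie_isomorphic (K : fieldType) (L1 L2 : lieAlgType K) : Prop :=
  exists f : {linear L1 -> L2},
    {morph f : x y / lie x y >-> lie x y} /\ bijective f.

Definition lie_closed (K : fieldType) (L : lieAlgType K) (S : {pred L}) :=
  {in S &, forall x y, lie x y \in S}.

Record lieSubalg (K : fieldType) (L : lieAlgType K) := LieSubalg {
  lieSubalg_pred :> {pred L};
  lieSubalg_submod : submod_closed lieSubalg_pred;
  lieSubalg_lie : lie_closed lieSubalg_pred }.

Section LieSubalgebraType.
Variables (K : fieldType) (L : lieAlgType K) (S : lieSubalg L).

HB.instance Definition _ :=
  GRing.isSubmodClosed.Build K L (lieSubalg_pred S) (lieSubalg_submod S).

Record lieSub_of := LieSubOf {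
  lieSub_val :> L;
  lieSub_valP : lieSub_val \in lieSubalg_pred S }.

HB.instance Definition _ := [isSub for lieSub_val].
HB.instance Definition _ := [Choice of lieSub_of by <:].
HB.instance Definition _ := [SubChoice_isSubLmodule of lieSub_of by <:].

Definition lieSub_lie (x y : lieSub_of) : lieSub_of :=
  LieSubOf (lieSubalg_lie (lieSub_valP x) (lieSub_valP y)).

Fact lieSub_lie_linearl k x y z :
  lieSub_lie (k *: x + y) z = k *: lieSub_lie x z + lieSub_lie y z.
Proof. by apply: val_inj; rewrite /= lie_linearl. Qed.

Fact lieSub_lie_linearr k x y z :
  lieSub_lie z (k *: x + y) = k *: lieSub_lie z x + lieSub_lie z y.
Proof. by apply: val_inj; rewrite /= lie_linearr. Qed.

Fact lieSub_liexx x : lieSub_lie x x = 0.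
Proof. by apply: val_inj; rewrite /= liexx. Qed.

Fact lieSub_lie_jacobi x y z :
  lieSub_lie x (lieSub_lie y z) + lieSub_lie y (lieSub_lie z x)
    + lieSub_lie z (lieSub_lie x y) = 0.
Proof. by apply: val_inj; rewrite /= lie_jacobi. Qed.

HB.instance Definition _ := Lmodule_isLieAlgebra.Build K lieSub_of
  lieSub_lie_linearl lieSub_lie_linearr lieSub_liexx lieSub_lie_jacobi.

End LieSubalgebraType.

(** * gl_n and sl_n *)

Definition gl (K : fieldType) (n : nat) : Type := 'M[K]_n.

Section MatrixLie.
Variables (K : fieldType) (n : nat).

HB.instance Definition _ := GRing.Lmodule.on (gl K n).

Definition mxcomm (A B : gl K n) : gl K n := A *m B - B *m A.

Fact mxcomm_linearl k (A B C : gl K n) :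
  mxcomm (k *: A + B) C = k *: mxcomm A C + mxcomm B C.
Proof.
rewrite /mxcomm mulmxDl mulmxDr -scalemxAl -scalemxAr scalerBr opprD.
by rewrite addrACA.
Qed.

Fact mxcomm_linearr k (A B C : gl K n) :
  mxcomm C (k *: A + B) = k *: mxcomm C A + mxcomm C B.
Proof.
rewrite /mxcomm mulmxDl mulmxDr -scalemxAl -scalemxAr scalerBr opprD.
by rewrite addrACA.
Qed.

Fact mxcommxx (A : gl K n) : mxcomm A A = 0.
Proof. exact: subrr. Qed.

Fact mxcomm_jacobi (A B C : gl K n) :
  mxcomm A (mxcomm B C) + mxcomm B (mxcomm C A) + mxcomm C (mxcomm A B) = 0.
Proof.
rewrite /mxcomm !mulmxBl !mulmxBr !mulmxA.
move: (A *m B *m C) (A *m C *m B) (B *m A *m C) (B *m C *m A)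
  (C *m A *m B) (C *m B *m A) => x1 x2 x3 x4 x5 x6.
by apply/matrixP=> i j; rewrite !mxE; ring.
Qed.

HB.instance Definition _ := Lmodule_isLieAlgebra.Build K (gl K n)
  mxcomm_linearl mxcomm_linearr mxcommxx mxcomm_jacobi.

Definition traceless : {pred gl K n} := fun A => \tr A == 0.

Fact traceless_submod : submod_closed traceless.
Proof.
split=> [|k A B]; rewrite !unfold_in ?mxtrace0 //.
by move=> /eqP trA /eqP trB; rewrite mxtraceD mxtraceZ trA trB mulr0 addr0.
Qed.

Fact traceless_lie : lie_closed traceless.
Proof. by move=> A B _ _; rewrite unfold_in linearB /= mxtrace_mulC subrr. Qed.

Definition sl_subalg : lieSubalg (gl K n) :=
  LieSubalg traceless_submod traceless_lie.

Definition sl : lieAlgType K := lieSub_of sl_subalg.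

End MatrixLie.

Arguments sl K n : clear implicits.

Section QuotientRule.
Variable E : fieldType.
Implicit Types p q r s : E.

Lemma quotient_rule_add p q r s p' q' r' s' : q != 0 -> s != 0 ->
  ((p' * s + p * s' + (r' * q + r * q')) * (q * s)
     - (p * s + r * q) * (q' * s + q * s')) / (q * s) ^+ 2
  = (p' * q - p * q') / q ^+ 2 + (r' * s - r * s') / s ^+ 2.
Proof. by move=> q0 s0; field; rewrite q0 s0. Qed.

Lemma quotient_rule_mul p q r s p' q' r' s' : q != 0 -> s != 0 ->
  ((p' * r + p * r') * (q * s) - p * r * (q' * s + q * s')) / (q * s) ^+ 2
  = (p' * q - p * q') / q ^+ 2 * (r / s)
    + p / q * ((r' * s - r * s') / s ^+ 2).
Proof. by move=> q0 s0; field; rewrite q0 s0. Qed.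

Lemma quotient_rule_comm p q p1 q1 p2 q2 p12 q12 : q != 0 ->
  ((p12 * q + p2 * q1 - (p1 * q2 + p * q12)) * (q * q)
     - (p2 * q - p * q2) * (q1 * q + q * q1)) / (q * q * (q * q))
  = ((p12 * q + p1 * q2 - (p2 * q1 + p * q12)) * (q * q)
     - (p1 * q - p * q1) * (q2 * q + q * q2)) / (q * q * (q * q)).
Proof. by move=> q0; field. Qed.

End QuotientRule.

(** * Extension of a derivation to the field of fractions *)

Section FractionDerivation.
Variable R : idomainType.
Implicit Types (D : R -> R) (p q r : R).
Local Notation F := {fraction R}.
Local Notation "x %:F" := (FracField.tofrac x).

(* Quotient rule applied to the chosen representative of the fraction; when D
   is a derivation, [fracderivE] shows that this choice is irrelevant. *)
Definition fracderiv D (x : F) : F :=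
  let r := repr x in
  (D \n_r * \d_r - \n_r * D \d_r)%:F / (\d_r ^+ 2)%:F.

Lemma tofrac_neq0 q : q != 0 -> q%:F != 0 :> F.
Proof. by rewrite tofrac_eq0. Qed.

Lemma fracE (x : F) : x = (\n_(repr x))%:F / (\d_(repr x))%:F.
Proof.
have d0 : (\d_(repr x))%:F != 0 :> F by rewrite tofrac_neq0 ?denom_ratioP.
apply: (mulIf d0); rewrite divfK // -{1}[x]reprK.
unlock FracField.tofrac; rewrite -[LHS]FracField.pi_mul.
apply/eqmodP; rewrite /= FracField.equivfE /FracField.mulf.
rewrite !numden_Ratio ?oner_eq0 ?mulf_neq0 ?denom_ratioP ?oner_eq0 //.
by rewrite !mulr1 mulrC.
Qed.

Lemma fracW (x : F) : exists2 d : R, d != 0 & exists n : R, x = n%:F / d%:F.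
Proof.
exists (\d_(repr x)); first exact: denom_ratioP.
by exists (\n_(repr x)); exact: fracE.
Qed.

Variable D : R -> R.
Hypothesis DD : {morph D : x y / x + y}.
Hypothesis DM : forall x y, D (x * y) = D x * y + x * D y.

Lemma fracderivE p q : q != 0 ->
  fracderiv D (p%:F / q%:F) = (D p * q - p * D q)%:F / (q ^+ 2)%:F.
Proof.
move=> q0; rewrite /fracderiv; set x := p%:F / q%:F.
have := fracE x; move: (denom_ratioP (repr x)).
move: (\n_(repr x)) (\d_(repr x)) => n d d0 xE.
have E : n * q = p * d.
  apply/eqP; rewrite -tofrac_eq !tofracM; apply/eqP.
  by move/eqP: xE; rewrite /x eqr_div ?tofrac_neq0 // => /eqP ->.
have E' : D n * q + n * D q = D p * d + p * D d by rewrite -!DM E.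
apply/eqP; rewrite eqr_div ?tofrac_neq0 ?expf_neq0 // -!tofracM tofrac_eq.
apply/eqP.
have -> : (D n * d - n * D d) * q ^+ 2 =
  (D n * q + n * D q) * (d * q) - (n * q) * D q * d - (n * q) * D d * q by ring.
by rewrite E' E; ring.
Qed.

Lemma fracderiv_tofrac p : fracderiv D p%:F = (D p)%:F.
Proof.
have D1 : D 1 = 0.
  by apply: (addrI (D 1)); rewrite addr0 -{3}[1]mulr1 DM mulr1 mul1r.
have -> : p%:F = p%:F / (1 : R)%:F :> F by rewrite tofrac1 divr1.
by rewrite fracderivE ?oner_eq0 // D1 mulr1 mulr0 subr0 expr1n tofrac1 divr1.
Qed.

Lemma fracderivD : {morph fracderiv D : x y / x + y}.
Proof.
move=> x y; have [q q0 [p ->]] := fracW x; have [s s0 [r ->]] := fracW y.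
have tq := tofrac_neq0 q0; have ts := tofrac_neq0 s0.
rewrite addf_div // -!(tofracM, tofracD) !fracderivE ?mulf_neq0 //.
rewrite !DD !DM !(tofracD, tofracN, tofracM, tofracXn).
exact: quotient_rule_add.
Qed.

Lemma fracderivM x y :
  fracderiv D (x * y) = fracderiv D x * y + x * fracderiv D y.
Proof.
have [q q0 [p ->]] := fracW x; have [s s0 [r ->]] := fracW y.
have tq := tofrac_neq0 q0; have ts := tofrac_neq0 s0.
rewrite mulf_div -!tofracM !fracderivE ?mulf_neq0 //.
rewrite !DM !(tofracD, tofracN, tofracM, tofracXn).
exact: quotient_rule_mul.
Qed.

End FractionDerivation.

Lemma fracderiv_comm (R : idomainType) (D D' : R -> R) :
  {morph D : x y / x + y} -> {morph D' : x y / x + y} ->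
  {morph D : x / - x} -> {morph D' : x / - x} ->
  (forall x y, D (x * y) = D x * y + x * D y) ->
  (forall x y, D' (x * y) = D' x * y + x * D' y) ->
  (forall x, D (D' x) = D' (D x)) ->
  forall x, fracderiv D (fracderiv D' x) = fracderiv D' (fracderiv D x).
Proof.
move=> DD DD' DN DN' DM DM' DDC x; have [q q0 [p ->]] := fracW x.
have tq := tofrac_neq0 q0.
rewrite !(fracderivE DM, fracderivE DM') ?expf_neq0 // !expr2.
rewrite !(DD, DD', DN, DN', DM, DM') !DDC.
rewrite !(tofracD, tofracN, tofracM, tofracXn).
exact: quotient_rule_comm.
Qed.

Section ContactBracket.
Variables (A : comNzRingType) (D1 D2 D3 : A -> A).
Hypotheses (D1B : {morph D1 : x y / x - y}) (D2B : {morph D2 : x y / x - y})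
  (D3B : {morph D3 : x y / x - y}).
Hypotheses (D1D : {morph D1 : x y / x + y}) (D2D : {morph D2 : x y / x + y})
  (D3D : {morph D3 : x y / x + y}).
Hypotheses (D1M : forall x y, D1 (x * y) = D1 x * y + x * D1 y)
  (D2M : forall x y, D2 (x * y) = D2 x * y + x * D2 y)
  (D3M : forall x y, D3 (x * y) = D3 x * y + x * D3 y).
Hypotheses (D12 : forall x, D1 (D2 x) = D2 (D1 x) + D3 x)
  (D13 : forall x, D1 (D3 x) = D3 (D1 x))
  (D23 : forall x, D2 (D3 x) = D3 (D2 x)).

Let br f g := g * D3 f - f * D3 g + D1 f * D2 g - D1 g * D2 f.

Lemma contact_jacobi f g h :
  br f (br g h) + br g (br h f) + br h (br f g) = 0.
Proof.
rewrite /br !(D1B, D2B, D3B, D1D, D2D, D3D, D1M, D2M, D3M).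
by rewrite !(D12, D13, D23); ring.
Qed.

Lemma contact_linearl k f g h : D1 k = 0 -> D2 k = 0 -> D3 k = 0 ->
  br (k * f + g) h = k * br f h + br g h.
Proof.
move=> k1 k2 k3; rewrite /br !(D1D, D2D, D3D, D1M, D2M, D3M) k1 k2 k3.
by ring.
Qed.

Lemma contact_antisym f g : br f g = - br g f.
Proof. by rewrite /br; ring. Qed.

End ContactBracket.

(** * The ring K[a, b, c, c^-1, (c - ab)^-1] *)

Section RegularFunctions.
Variable K : fieldType.

Local Notation P := {mpoly K[3]}.
Local Notation F := {fraction P}.
Local Notation "x %:F" := (FracField.tofrac x).

Definition pa : P := 'X_0.
Definition pb : P := 'X_1.
Definition pc : P := 'X_2.

Definition regden (m n : nat) : P := pc ^+ m * (pc - pa * pb) ^+ n.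

Definition regular : {pred F} :=
  fun x => `[< exists (p : P) (m n : nat), x = p%:F / (regden m n)%:F >].

Definition fderiv (i : 'I_3) : F -> F := fracderiv (mderiv i).

Lemma pc_neq0 : pc != 0.
Proof.
apply/eqP=> /(congr1 (mcoeff U_(2))) /eqP.
by rewrite mcoeffX eqxx mcoeff0 oner_eq0.
Qed.

Lemma pcab_neq0 : pc - pa * pb != 0.
Proof.
apply/eqP=> /(congr1 (mcoeff U_(2))) /eqP.
rewrite mcoeffB -mpolyXD !mcoeffX eqxx mcoeff0.
have /negPf-> : (U_(0%R) + U_(1%R))%MM != U_(2%R)%MM :> 'X_{1..3}.
  by apply/eqP=> E; have := congr1 (fun m : 'X_{1..3} => m 0) E;
    rewrite mnmDE !mnm1E.
by rewrite subr0 oner_eq0.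
Qed.

Lemma regden_neq0 m n : regden m n != 0.
Proof. by rewrite mulf_neq0 ?expf_neq0 ?pc_neq0 ?pcab_neq0. Qed.

Lemma regdenM m n m' n' :
  regden m n * regden m' n' = regden (m + m') (n + n').
Proof. by rewrite /regden mulrACA -!exprD. Qed.

Lemma fderivE i (p q : P) : q != 0 ->
  fderiv i (p%:F / q%:F) = (mderiv i p * q - p * mderiv i q)%:F / (q ^+ 2)%:F.
Proof. exact: (fracderivE (mderivM i)). Qed.

Lemma fderiv_tofrac i (p : P) : fderiv i p%:F = (mderiv i p)%:F.
Proof. exact: (fracderiv_tofrac (mderivM i)). Qed.

Lemma fderivD i : {morph fderiv i : x y / x + y}.
Proof. exact: (fracderivD (mderivD i) (mderivM i)). Qed.

Lemma fderivM i x y : fderiv i (x * y) = fderiv i x * y + x * fderiv i y.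
Proof. exact: (fracderivM (mderivM i)). Qed.

Lemma fderiv_comm i j x : fderiv i (fderiv j x) = fderiv j (fderiv i x).
Proof.
apply: (fracderiv_comm (mderivD i) (mderivD j) (mderivN i) (mderivN j)
  (mderivM i) (mderivM j)) => p.
exact: mderiv_comm.
Qed.

Fact regular_subring : subring_closed regular.
Proof.
have tr0 m n : (regden m n)%:F != 0 :> F by rewrite tofrac_eq0 regden_neq0.
split.
- apply/asboolP; exists 1, 0, 0.
  by rewrite /regden !expr0 mulr1 tofrac1 divr1.
- move=> x y /asboolP[p [m [n ->]]] /asboolP[q [m' [n' ->]]]; apply/asboolP.
  exists (p * regden m' n' - q * regden m n), (m + m')%N, (n + n')%N.
  rewrite -mulNr addf_div //.
  by rewrite -regdenM tofracB !tofracM mulNr.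
- move=> x y /asboolP[p [m [n ->]]] /asboolP[q [m' [n' ->]]]; apply/asboolP.
  exists (p * q), (m + m')%N, (n + n')%N.
  by rewrite -regdenM !tofracM mulf_div.
Qed.

Fact fderiv_regular i x : x \in regular -> fderiv i x \in regular.
Proof.
move=> /asboolP[p [m [n ->]]]; apply/asboolP.
rewrite fderivE ?regden_neq0 // expr2 regdenM.
by exists (mderiv i p * regden m n - p * mderiv i (regden m n)),
  (m + m)%N, (n + n)%N.
Qed.

Fact tofrac_regular (p : P) : p%:F \in regular.
Proof.
apply/asboolP; exists p, 0, 0.
by rewrite /regden !expr0 mulr1 tofrac1 divr1.
Qed.

HB.instance Definition _ :=
  GRing.isSubringClosed.Build F regular regular_subring.

Record regfun := RegFun { regfun_val : F; regfun_valP : regfun_val \in regular }.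

HB.instance Definition _ := [isSub for regfun_val].
HB.instance Definition _ := [Choice of regfun by <:].
HB.instance Definition _ := [SubChoice_isSubComNzRing of regfun by <:].

Definition regpoly (p : P) : regfun := RegFun (tofrac_regular p).

Definition regscale (k : K) (f : regfun) : regfun := regpoly k%:MP * f.

Fact regscaleA k l f : regscale k (regscale l f) = regscale (k * l) f.
Proof. by apply: val_inj; rewrite /= rmorphM /= tofracM mulrA. Qed.

Fact regscale1 : left_id 1 regscale.
Proof. by move=> f; apply: val_inj; rewrite /= mpolyC1 tofrac1 mul1r. Qed.

Fact regscaleDr : right_distributive regscale +%R.
Proof. by move=> k f g; rewrite /regscale mulrDr. Qed.

Fact regscaleDl f : {morph regscale^~ f : k l / k + l}.
Proof.
by move=> k l; apply: val_inj; rewrite /= rmorphD /= tofracD mulrDl.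
Qed.

HB.instance Definition _ := GRing.Zmodule_isLmodule.Build K regfun
  regscaleA regscale1 regscaleDr regscaleDl.

Fact regscaleAl (k : K) (f g : regfun) : k *: (f * g) = (k *: f) * g.
Proof. exact: mulrA. Qed.

HB.instance Definition _ :=
  GRing.Lmodule_isLalgebra.Build K regfun regscaleAl.

(** * The bracket *)

Definition regderiv (i : 'I_3) (f : regfun) : regfun :=
  RegFun (fderiv_regular i (regfun_valP f)).

Definition d1 (f : regfun) : regfun := regderiv 0 f.
Definition d2 (f : regfun) : regfun := regderiv 1 f + regpoly pa * regderiv 2 f.
Definition d3 (f : regfun) : regfun := regderiv 2 f.

Definition regbracket (f g : regfun) : regfun :=
  g * d3 f - f * d3 g + d1 f * d2 g - d1 g * d2 f.

Lemma regfun_valD (f g : regfun) :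
  regfun_val (f + g) = regfun_val f + regfun_val g.
Proof. exact: (raddfD (val : regfun -> F)). Qed.

Lemma regfun_valM (f g : regfun) :
  regfun_val (f * g) = regfun_val f * regfun_val g.
Proof. exact: (rmorphM (val : regfun -> F)). Qed.

Lemma regfun_val_deriv i (f : regfun) :
  regfun_val (regderiv i f) = fderiv i (regfun_val f).
Proof. by []. Qed.

Lemma regderivD i : {morph regderiv i : f g / f + g}.
Proof.
move=> f g; apply: val_inj; rewrite [LHS]regfun_val_deriv regfun_valD fderivD.
by rewrite [RHS]regfun_valD !regfun_val_deriv.
Qed.

Lemma regderivM i f g :
  regderiv i (f * g) = regderiv i f * g + f * regderiv i g.
Proof.
apply: val_inj; rewrite [LHS]regfun_val_deriv regfun_valM fderivM.
by rewrite [RHS]regfun_valD !regfun_valM !regfun_val_deriv.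
Qed.

Lemma regderivN i : {morph regderiv i : f / - f}.
Proof.
move=> f; apply: (addrI (regderiv i f)); rewrite -regderivD !subrr.
by apply: (addrI (regderiv i 0)); rewrite -regderivD !addr0.
Qed.

Lemma regderiv_poly i p : regderiv i (regpoly p) = regpoly (mderiv i p).
Proof. by apply: val_inj; rewrite [LHS]regfun_val_deriv fderiv_tofrac. Qed.

Lemma regderiv_comm i j f :
  regderiv i (regderiv j f) = regderiv j (regderiv i f).
Proof.
apply: val_inj; rewrite [LHS]regfun_val_deriv [RHS]regfun_val_deriv.
by rewrite !regfun_val_deriv fderiv_comm.
Qed.

Lemma regpoly0 : regpoly 0 = 0.
Proof. by apply: val_inj; rewrite [LHS]tofrac0. Qed.

Lemma regpoly1 : regpoly 1 = 1.
Proof. by apply: val_inj; rewrite [LHS]tofrac1. Qed.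

Lemma regderivZ i (k : K) f : regderiv i (k *: f) = k *: regderiv i f.
Proof.
by rewrite [LHS]regderivM regderiv_poly mderivC regpoly0 mul0r add0r.
Qed.

Lemma regderiv_pa i : regderiv i (regpoly pa) = (i == 0)%:R.
Proof.
rewrite regderiv_poly mderivX mnm1E eq_sym.
case: eqP => [->|_]; last by rewrite scale0r regpoly0.
by rewrite scale1r -{1}[U_(0%R)%MM]add0m addmK mpolyX0 regpoly1.
Qed.

Lemma regderivB i : {morph regderiv i : f g / f - g}.
Proof. by move=> f g; rewrite regderivD regderivN. Qed.

Lemma d2D : {morph d2 : f g / f + g}.
Proof. by move=> f g; rewrite /d2 !regderivD mulrDr addrACA. Qed.

Lemma d2B : {morph d2 : f g / f - g}.
Proof. by move=> f g; rewrite /d2 !regderivB mulrBr opprD addrACA. Qed.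

Lemma d2M f g : d2 (f * g) = d2 f * g + f * d2 g.
Proof.
rewrite /d2 !regderivM !mulrDr !mulrDl addrACA; congr (_ + _ + _).
  by rewrite mulrA.
by rewrite mulrCA.
Qed.

Lemma d1d2 f : d1 (d2 f) = d2 (d1 f) + d3 f.
Proof.
rewrite /d1 /d2 /d3 regderivD regderivM regderiv_pa eqxx mul1r.
by rewrite !(regderiv_comm 0) [regderiv 2 f + _]addrC addrA.
Qed.

Lemma d1d3 f : d1 (d3 f) = d3 (d1 f).
Proof. exact: regderiv_comm. Qed.

Lemma d2d3 f : d2 (d3 f) = d3 (d2 f).
Proof.
rewrite /d2 /d3 regderivD regderivM regderiv_pa /= mul0r add0r.
by rewrite (regderiv_comm 1).
Qed.

Lemma regderiv_const i (k : K) : regderiv i (regpoly k%:MP) = 0.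
Proof. by rewrite regderiv_poly mderivC regpoly0. Qed.

Lemma d2_const (k : K) : d2 (regpoly k%:MP) = 0.
Proof. by rewrite /d2 !regderiv_const mulr0 addr0. Qed.

Fact regbracket_linearl (k : K) f g h :
  regbracket (k *: f + g) h = k *: regbracket f h + regbracket g h.
Proof.
apply: (contact_linearl (regderivD 0) d2D (regderivD 2)
  (regderivM 0) d2M (regderivM 2)).
- exact: regderiv_const.
- exact: d2_const.
- exact: regderiv_const.
Qed.

Lemma regbracket_antisym f g : regbracket f g = - regbracket g f.
Proof. exact: contact_antisym. Qed.

Fact regbracket_linearr (k : K) f g h :
  regbracket h (k *: f + g) = k *: regbracket h f + regbracket h g.
Proof.
rewrite !(regbracket_antisym h) regbracket_linearl opprD; congr (_ + _).
by rewrite -mulrN.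
Qed.

Fact regbracketxx f : regbracket f f = 0.
Proof. by rewrite /regbracket subrr add0r subrr. Qed.

Fact regbracket_jacobi f g h :
  regbracket f (regbracket g h) + regbracket g (regbracket h f)
    + regbracket h (regbracket f g) = 0.
Proof.
exact: (contact_jacobi (regderivB 0) d2B (regderivB 2)
  (regderivD 0) d2D (regderivD 2) (regderivM 0) d2M (regderivM 2)
  d1d2 d1d3 d2d3).
Qed.

HB.instance Definition _ := Lmodule_isLieAlgebra.Build K regfun
  regbracket_linearl regbracket_linearr regbracketxx regbracket_jacobi.

End RegularFunctions.

(* Main.v *)
From HB Require Import structures.
Require Import Defs.
From mathcomp Require Import all_boot all_order all_algebra.
From mathcomp Require Import mpoly.
From mathcomp Require Import complex.
From mathcomp Require Import boolp.
From mathcomp Require Import reals.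
From mathcomp Require Import ring.

Local Open Scope ring_scope.
Import GRing.Theory Num.Theory.

(** The bracket is the Lagrange bracket of the contact form dc - a db, and a
    neighbourhood of a point of the variety of complete flags (point on a line)
    in the projective plane carries these coordinates: the point is
    v = (1, b, c)^T, and the line is the covector xi = (ab - c, -a, 1), which
    kills v.  The group SL_3 acts on flags by contact transformations, and the
    Hamiltonian of the infinitesimal action of a matrix A is the polynomial
    xi A v.  So the copy of sl_3 in V is already made of polynomials; it is
    spanned by 1, a, b, c, ab, ac, b(c - ab) and c(c - ab).

    That A |-> xi A v respects the brackets is a completeness relation.  The
    vectors v, d2 v, d3 v form a frame with dual coframe -d3 xi, -d1 xi, xi, so
    the identity matrix is the sum of the three corresponding rank-one matrices
    [flag_frame].  Inserted between A and B in xi A B v, it writes this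
    polynomial through first-order data of xi A v and xi B v [flag_form_mul],
    because d1 v = 0 and d2 xi = 0; antisymmetrizing in A and
    B gives exactly the bracket [flag_form_bracket].  This holds on all of gl_3.

    If xi A v vanishes at every flag then A is scalar; a traceless A is then
    zero in characteristic 0 [flag_form_eq0].  So sl_3 embeds in V, and the
    image of the embedding is the required subalgebra
    [lie_embedding_isomorphic]. *)

(** * Images of injective Lie morphisms *)

Lemma lie_embedding_isomorphic (K : fieldType) (L M : lieAlgType K)
    (phi : {linear L -> M}) :
  {morph phi : x y / lie x y >-> lie x y} -> injective phi ->
  exists S : lieSubalg M, lie_isomorphic (lieSub_of S) L.
Proof.
move=> phiL phi_inj.
pose im : {pred M} := fun y => `[< exists x, phi x = y >].
have im_submod : submod_closed im.
  split=> [|k y z]; first by apply/asboolP; exists 0; rewrite linear0.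
  move=> /asboolP[x <-] /asboolP[x' <-]; apply/asboolP.
  by exists (k *: x + x'); rewrite linearP.
have im_lie : lie_closed im.
  move=> y z /asboolP[x <-] /asboolP[x' <-]; apply/asboolP.
  by exists (lie x x').
exists (LieSubalg im_submod im_lie).
set S := LieSubalg _ _.
(* psi is a choice of preimages; injectivity of phi makes it a morphism. *)
pose psi (y : lieSub_of S) : L := projT1 (cid (asboolW (lieSub_valP y))).
have psiK y : phi (psi y) = lieSub_val y.
  by rewrite /psi; case: cid.
have psi_lin : linear psi.
  by move=> k y z; apply: phi_inj; rewrite linearP !psiK.
pose psiM := GRing.isLinear.Build K (lieSub_of S) L *:%R psi psi_lin.
pose psiL : {linear lieSub_of S -> L} := HB.pack psi psiM.
exists psiL; split=> [y z|].
  by apply: phi_inj; rewrite phiL /= !psiK.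
have im_phi x : phi x \in lieSubalg_pred S by apply/asboolP; exists x.
exists (fun x => LieSubOf (im_phi x)) => [y|x].
  by apply: val_inj; rewrite /= psiK.
by apply: phi_inj; rewrite /= psiK.
Qed.

(** * The Hamiltonians of gl_3 on the flag variety *)

Section FlagVariety.
Variable K : fieldType.
Local Notation P := {mpoly K[3]}.
Local Notation pa := (pa K).
Local Notation pb := (pb K).
Local Notation pc := (pc K).

Definition cderiv1 (p : P) : P := mderiv 0 p.
Definition cderiv2 (p : P) : P := mderiv 1 p + pa * mderiv 2 p.
Definition cderiv3 (p : P) : P := mderiv 2 p.

(** Homogeneous coordinates of the point of the flag, and below of its line,
    whose slope is a: the form dc - a db measures how far a moving point leaves
    its line. *)
Definition flag_point : 'cV[P]_3 := \col_i [:: 1; pb; pc]`_i.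
Definition flag_line : 'rV[P]_3 := \row_i [:: pa * pb - pc; - pa; 1]`_i.

Definition flag_form (A : 'M[K]_3) : P :=
  (flag_line *m map_mx (@mpolyC 3 K) A *m flag_point) 0 0.

(** The entries of A are constants, so the Leibniz rule for xi A v has only two
    terms. *)
Lemma derivation_form (D : P -> P) (u : 'rV[P]_3) (A : 'M[K]_3)
    (v : 'cV[P]_3) :
  {morph D : p q / p + q} -> (forall p q, D (p * q) = D p * q + p * D q) ->
  (forall k : K, D k%:MP = 0) ->
  D ((u *m map_mx (@mpolyC 3 K) A *m v) 0 0)
  = (map_mx D u *m map_mx (@mpolyC 3 K) A *m v) 0 0
    + (u *m map_mx (@mpolyC 3 K) A *m map_mx D v) 0 0.
Proof.
move=> DD DM DC.
have D0 : D 0 = 0 by have := DC 0; rewrite mpolyC0.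
rewrite !mxE (big_morph D DD D0) -big_split; apply: eq_bigr => j _ /=.
rewrite DM !mxE (big_morph D DD D0); congr (_ * _ + _).
by apply: eq_bigr => i _; rewrite !mxE DM DC mulr0 addr0.
Qed.

Lemma mderiv_var i j : mderiv i ('X_j : P) = (i == j)%:R.
Proof.
rewrite mderivX mnm1E eq_sym; case: eqVneq => [->|_]; last by rewrite scale0r.
by rewrite scale1r -{1}[U_(j)%MM]add0m addmK mpolyX0.
Qed.

Lemma mderiv_coord i :
  (mderiv i pa = (i == 0)%:R) * (mderiv i pb = (i == 1)%:R)
  * (mderiv i pc = (i == 2)%:R).
Proof. by split; [split|]; apply: mderiv_var. Qed.

Lemma mderiv1 i : mderiv i (1 : P) = 0.
Proof. by rewrite -mpolyC1 mderivC. Qed.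

Definition mderiv_simp := (mderivB, mderivN, mderivM, mderiv_coord,
  mderiv1, mxE).

Lemma cderiv1_point : map_mx cderiv1 flag_point = 0.
Proof.
apply/matrixP=> i j; rewrite !mxE /cderiv1.
by case: i => [[|[|[|//]]] ?]; rewrite /= !mderiv_simp.
Qed.

(** The vector field d2 moves the point of the flag along its line. *)
Lemma cderiv2_line : map_mx cderiv2 flag_line = 0.
Proof.
apply/matrixP=> i j; rewrite !mxE /cderiv2.
by case: j => [[|[|[|//]]] ?]; rewrite /= !mderiv_simp /=; ring.
Qed.

(** The covectors -d3 xi, -d1 xi, xi are the basis dual to v, d2 v, d3 v: this
    is the resolution of the identity for that pair of bases.  It holds over the
    polynomial ring because the frame is unitriangular. *)
Lemma flag_frame :
  1%:M = - (flag_point *m map_mx cderiv3 flag_line)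
         - map_mx cderiv2 flag_point *m map_mx cderiv1 flag_line
         + map_mx cderiv3 flag_point *m flag_line.
Proof.
apply/matrixP=> i j; rewrite !mxE !big_ord1 !mxE /cderiv1 /cderiv2 /cderiv3.
by case: i => [[|[|[|//]]] ?]; case: j => [[|[|[|//]]] ?];
  rewrite /= !mderiv_simp /=; ring.
Qed.

Lemma cderiv1_form A : cderiv1 (flag_form A) =
  (map_mx cderiv1 flag_line *m map_mx (@mpolyC 3 K) A *m flag_point) 0 0.
Proof.
rewrite /flag_form (derivation_form cderiv1).
- by rewrite cderiv1_point mulmx0 [X in _ + X]mxE addr0.
- exact: mderivD.
- exact: mderivM.
- exact: mderivC.
Qed.

Lemma cderiv2_form A : cderiv2 (flag_form A) =
  (flag_line *m map_mx (@mpolyC 3 K) A *m map_mx cderiv2 flag_point) 0 0.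
Proof.
rewrite /flag_form (derivation_form cderiv2).
- by rewrite cderiv2_line !mul0mx [X in X + _]mxE add0r.
- by move=> p q; rewrite /cderiv2 !mderivD; ring.
- by move=> p q; rewrite /cderiv2 !mderivM; ring.
- by move=> k; rewrite /cderiv2 !mderivC mulr0 addr0.
Qed.

Lemma cderiv3_form A : cderiv3 (flag_form A) =
  (map_mx cderiv3 flag_line *m map_mx (@mpolyC 3 K) A *m flag_point) 0 0
  + (flag_line *m map_mx (@mpolyC 3 K) A *m map_mx cderiv3 flag_point) 0 0.
Proof.
apply: derivation_form; [exact: mderivD|exact: mderivM|exact: mderivC].
Qed.

Lemma mulmx11E (B C : 'M[P]_1) : (B *m C) 0 0 = B 0 0 * C 0 0.
Proof. by rewrite mxE big_ord1. Qed.

(** The resolution of the identity is inserted between A and B; the middle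
    summand is a product of derivatives of the two forms because v does not
    depend on a and xi is constant along d2. *)
Lemma flag_form_mul A B : flag_form (A *m B) =
  - (flag_form A *
      (map_mx cderiv3 flag_line *m map_mx (@mpolyC 3 K) B *m flag_point) 0 0)
  - cderiv2 (flag_form A) * cderiv1 (flag_form B)
  + (flag_line *m map_mx (@mpolyC 3 K) A *m map_mx cderiv3 flag_point) 0 0
      * flag_form B.
Proof.
rewrite cderiv1_form cderiv2_form /flag_form map_mxM /=.
rewrite -[X in X *m map_mx _ B]mulmx1 flag_frame.
rewrite -!mulmx11E !(mulmxDl, mulmxDr, mulmxN, mulNmx, mulmxA).
by rewrite [LHS]mxE [X in X + _]mxE; congr (_ + _ + _); rewrite mxE.
Qed.

(** The two summands of d3 applied to xi A v come from the two outer terms of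
    the resolution of the identity, which is why no correction remains after
    antisymmetrization. *)
Lemma flag_form_bracket A B : flag_form (A *m B - B *m A) =
  flag_form B * cderiv3 (flag_form A) - flag_form A * cderiv3 (flag_form B)
  + cderiv1 (flag_form A) * cderiv2 (flag_form B)
  - cderiv1 (flag_form B) * cderiv2 (flag_form A).
Proof.
have formB X Y : flag_form (X - Y) = flag_form X - flag_form Y.
  by rewrite /flag_form map_mxB mulmxBr mulmxBl mxE; congr (_ + _); rewrite mxE.
(* f3 and f3' stand for the two summands of d3 f, in which xi, respectively v, is
   differentiated. *)
have alg (f g f1 g1 f2 g2 f3 g3 f3' g3' : P) :
    (- (f * g3) - f2 * g1 + f3' * g) - (- (g * f3) - g2 * f1 + g3' * f)
    = g * (f3 + f3') - f * (g3 + g3') + f1 * g2 - g1 * f2 by ring.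
by rewrite formB (flag_form_mul A) (flag_form_mul B) (cderiv3_form A)
  (cderiv3_form B) alg.
Qed.

(** * Transport to regular functions *)

Lemma regpolyB : {morph @regpoly K : p q / p - q}.
Proof. by move=> p q; apply: val_inj; rewrite /= tofracB. Qed.

Lemma regpolyD : {morph @regpoly K : p q / p + q}.
Proof. by move=> p q; apply: val_inj; rewrite /= tofracD. Qed.

Lemma regpolyM : {morph @regpoly K : p q / p * q}.
Proof. by move=> p q; apply: val_inj; rewrite /= tofracM. Qed.

Lemma regpolyZ k : {morph @regpoly K : p / k *: p}.
Proof. by move=> p; apply: val_inj; rewrite /= -mul_mpolyC tofracM. Qed.

Lemma regbracket_poly (p q : P) :
  regbracket (regpoly p) (regpoly q) =
  regpoly (q * cderiv3 p - p * cderiv3 q + cderiv1 p * cderiv2 q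
           - cderiv1 q * cderiv2 p).
Proof.
have d1E r : d1 (regpoly r) = regpoly (cderiv1 r) by exact: regderiv_poly.
have d3E r : d3 (regpoly r) = regpoly (cderiv3 r) by exact: regderiv_poly.
have d2E r : d2 (regpoly r) = regpoly (cderiv2 r).
  by rewrite /d2 (regderiv_poly 1) (regderiv_poly 2) regpolyD regpolyM.
rewrite /regbracket (d1E p) (d1E q) (d2E p) (d2E q) (d3E p) (d3E q).
by rewrite regpolyB (regpolyD (_ - _)) regpolyB !regpolyM.
Qed.

Definition sl_hamiltonian (A : sl K 3) : regfun K :=
  regpoly (flag_form (lieSub_val A)).

Lemma sl_hamiltonian_linear : linear sl_hamiltonian.
Proof.
move=> k A B; rewrite /sl_hamiltonian.
rewrite -regpolyZ -regpolyD; congr regpoly.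
rewrite /flag_form [lieSub_val _]/(k *: lieSub_val A + lieSub_val B).
rewrite map_mxD map_mxZ mulmxDr mulmxDl -scalemxAr -scalemxAl.
by rewrite mxE [X in X + _]mxE mul_mpolyC.
Qed.

HB.instance Definition _ := GRing.isLinear.Build K (sl K 3) (regfun K) *:%R
  sl_hamiltonian sl_hamiltonian_linear.

Lemma sl_hamiltonian_lie :
  {morph sl_hamiltonian : A B / lie A B >-> lie A B}.
Proof.
move=> A B; rewrite [RHS]regbracket_poly; congr regpoly.
exact: flag_form_bracket.
Qed.

End FlagVariety.

(** * Injectivity on traceless matrices *)

Lemma flag_form_eval (K : fieldType) (A : 'M[K]_3) (x : 'I_3 -> K) :
  (flag_form K A).@[x]
  = (x 0 * x 1 - x 2) * (A 0 0 + A 0 1 * x 1 + A 0 2 * x 2)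
    - x 0 * (A 1 0 + A 1 1 * x 1 + A 1 2 * x 2)
    + (A 2 0 + A 2 1 * x 1 + A 2 2 * x 2).
Proof.
rewrite /flag_form !mxE !big_ord_recl big_ord0 !mxE.
rewrite !big_ord_recl !big_ord0 !mxE /=.
have E1 : lift ord0 ord0 = 1 :> 'I_3 by apply: val_inj.
have E2 : lift ord0 (lift ord0 ord0) = 2 :> 'I_3 by apply: val_inj.
have E0 : ord0 = 0 :> 'I_3 by apply: val_inj.
rewrite E1 E2 E0 !(mevalD, mevalM, mevalB, mevalN, meval1, mevalC, mevalXU).
ring.
Qed.

(** Vanishing of xi A v at a few flags with coordinates 0, 1 and -1 already
    forces A to be scalar: every entry off the diagonal, and every difference of
    diagonal entries, is a combination of these values, with denominator at most
    2.  The trace then divides by 3. *)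
Lemma flag_form_eq0 (K : numFieldType) (A : 'M[K]_3) :
  \tr A = 0 -> flag_form K A = 0 -> A = 0.
Proof.
move=> trA A0.
pose e a b c :=
  (a * b - c) * (A 0 0 + A 0 1 * b + A 0 2 * c)
    - a * (A 1 0 + A 1 1 * b + A 1 2 * c)
    + (A 2 0 + A 2 1 * b + A 2 2 * c).
have e0 a b c : e a b c = 0.
  have := flag_form_eval K A (fun i => [:: a; b; c]`_i).
  by rewrite A0 meval0.
have A20 : A 2 0 = 0 by rewrite -(e0 0 0 0) /e; ring.
have A10 : A 1 0 = 0.
  have -> : A 1 0 = e 0 0 0 - e 1 0 0 by rewrite /e; ring.
  by rewrite !e0 subr0.
have A21 : A 2 1 = 0.
  have -> : A 2 1 = e 0 1 0 - e 0 0 0 by rewrite /e; ring.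
  by rewrite !e0 subr0.
have two0 : 2%:R != 0 :> K by rewrite pnatr_eq0.
have three0 : 3%:R != 0 :> K by rewrite pnatr_eq0.
have A02 : A 0 2 = 0.
  apply: (mulfI two0).
  have -> : 2%:R * A 0 2 = 2%:R * e 0 0 0 - e 0 0 1 - e 0 0 (-1).
    by rewrite /e; ring.
  by rewrite !e0 !mulr0 !subr0.
have A01 : A 0 1 = 0.
  apply: (mulfI two0).
  have -> : 2%:R * A 0 1 = e 1 1 0 + e 1 (-1) 0 - 2%:R * e 1 0 0.
    by rewrite /e; ring.
  by rewrite !e0 !mulr0 subr0 addr0.
have A11 : A 1 1 = A 0 0.
  apply/eqP; rewrite -subr_eq0; apply/eqP.
  have -> : A 1 1 - A 0 0 = A 0 1 - A 1 0 + A 2 0 + A 2 1 - e 1 1 0.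
    by rewrite /e; ring.
  by rewrite e0 A01 A10 A20 A21 !(subr0, addr0).
have A22 : A 2 2 = A 0 0.
  apply/eqP; rewrite -subr_eq0; apply/eqP.
  have -> : A 2 2 - A 0 0 = e 0 0 1 + A 0 2 - A 2 0 by rewrite /e; ring.
  by rewrite e0 A02 A20 !(subr0, addr0).
have A12 : A 1 2 = 0.
  have -> : A 1 2 = A 2 2 - A 0 0 - A 0 2 - A 1 0 + A 2 0 - e 1 0 1.
    by rewrite /e; ring.
  by rewrite e0 A02 A20 A22 A10 subrr !(subr0, addr0).
have A00 : A 0 0 = 0.
  apply: (mulfI three0); rewrite mulr0 -trA /mxtrace !big_ord_recl big_ord0.
  have -> : lift ord0 ord0 = 1 :> 'I_3 by apply: val_inj.
  have -> : lift ord0 (lift ord0 ord0) = 2 :> 'I_3 by apply: val_inj.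
  by rewrite A11 A22; ring.
have ordE (i : 'I_3) : [\/ i = 0, i = 1 | i = 2].
  by case: i => [[|[|[|//]]] ?]; [constructor 1|constructor 2|constructor 3];
    apply: val_inj.
apply/matrixP=> i j; rewrite mxE.
by have [->|->|->] := ordE i; have [->|->|->] := ordE j;
  rewrite ?A00 ?A11 ?A22.
Qed.

Lemma sl_hamiltonian_inj (K : numFieldType) : injective (sl_hamiltonian K).
Proof.
apply: raddf_inj => A /(congr1 val) /=/eqP.
rewrite tofrac_eq0 => /eqP /flag_form_eq0 A0.
apply: val_inj; rewrite [RHS]/(0 : 'M[K]_3); apply: A0.
exact/eqP/(lieSub_valP A).
Qed.

Theorem proposition7p2 (R : realType) :
  exists S : lieSubalg (regfun R[i]),
    lie_isomorphic (lieSub_of S) (sl R[i] 3).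
Proof.
exact: lie_embedding_isomorphic (@sl_hamiltonian_lie _) (@sl_hamiltonian_inj _).
Qed.
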